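(* Let $X(\mathbb{Z})$ be a reflexive translation-invariant Banach sequence space. If $a\in M_{X(\mathbb{Z})}$, then $$\|L^\pi(a)\|_{\mathcal{B}(X(\mathbb{Z}))/\mathcal{K}(X(\mathbb{Z}))}=\|L(a)\|_{\mathcal{B}(X(\mathbb{Z}))},\qquad \|T^\pi(a)\|_{\mathcal{B}(X(\mathbb{Z}_+))/\mathcal{K}(X(\mathbb{Z}_+))}=\|T(a)\|_{\mathcal{B}(X(\mathbb{Z}_+))}.$$
   Context: Let $\ell^0(\mathbb{Z})$ be the space of all sequences $\mathbb{Z}\to\mathbb{C}$ and $\ell^0_+(\mathbb{Z})$ its cone of nonnegative sequences. A Banach function norm is a map $\varrho:\ell^0_+(\mathbb{Z})\to[0,\infty]$ such that for all $f,g,f^{(n)}\in\ell^0_+(\mathbb{Z})$, $\alpha\ge0$ and finite $E\subset\mathbb{Z}$: (A1) $\varrho(f)=0\Leftrightarrow f=0$, $\varrho(\alpha f)=\alpha\varrho(f)$, $\varrho(f+g)\le\varrho(f)+\varrho(g)$; (A2) $0\le g\le f\Rightarrow\varrho(g)\le\varrho(f)$; (A3) $0\le f^{(n)}\uparrow f\Rightarrow\varrho(f^{(n)})\uparrow\varrho(f)$; (A4) $\varrho(\chi_E)<\infty$ ($\chi_E$ the indicator of $E$); (A5) $\sum_{k\in E}f_k\le C_E\varrho(f)$ with $C_E\in(0,\infty)$ independent of $f$. The Banach sequence space is $X(\mathbb{Z})=\{f\in\ell^0(\mathbb{Z}):\varrho(|f|)<\infty\}$ with norm $\|f\|_{X(\mathbb{Z})}=\varrho(|f|)$.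 It is translation-invariant if for every $\varphi\in X(\mathbb{Z})$ the shifted sequence $\{\varphi_{j-1}\}_{j\in\mathbb{Z}}$ belongs to $X(\mathbb{Z})$ and has the same norm as $\varphi$. A reflexive Banach sequence space is separable. $\mathbb{Z}_+=\{0,1,2,\dots\}$; $(P\varphi)_j=\varphi_j$ for $j\in\mathbb{Z}_+$ and $0$ otherwise; $X(\mathbb{Z}_+):=PX(\mathbb{Z})$ with the norm of $X(\mathbb{Z})$. $S_0(\mathbb{Z})$ is the set of finitely supported sequences, $S_0(\mathbb{Z}_+)=PS_0(\mathbb{Z})$. For a $2\pi$-periodic distribution $a\in\mathcal{P}'$ with Fourier coefficients $\{\widehat a_j\}_{j\in\mathbb{Z}}$ and $\varphi\in S_0(\mathbb{Z})$, $(a*\varphi)_j:=\sum_k\widehat a_{j-k}\varphi_k$. $M_{X(\mathbb{Z})}$ is the set of $a\in\mathcal{P}'$ with $a*\varphi\in X(\mathbb{Z})$ for all $\varphi\in S_0(\mathbb{Z})$ and $\|a\|_{M_{X(\mathbb{Z})}}:=\sup\{\|a*\varphi\|_{X(\mathbb{Z})}/\|\varphi\|_{X(\mathbb{Z})}:\varphi\in S_0(\mathbb{Z}),\varphi\neq0\}<\infty$. When $X(\mathbb{Z})$ is separable, $S_0(\mathbb{Z})$ is dense in $X(\mathbb{Z})$ and $S_0(\mathbb{Z}_+)$ is dense in $X(\mathbb{Z}_+)$; the Laurent operator $L(a)$ is the bounded extension to $X(\mathbb{Z})$ of $\varphi\mapsto a*\varphi$ ($\varphi\in S_0(\mathbb{Z})$),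 and the discrete Wiener-Hopf operator $T(a)$ is the bounded extension to $X(\mathbb{Z}_+)$ of $\varphi\mapsto P(a*\varphi)$ ($\varphi\in S_0(\mathbb{Z}_+)$). $\mathcal{B}(\mathcal{X})$, $\mathcal{K}(\mathcal{X})$ are the bounded and the compact linear operators on a Banach space $\mathcal{X}$; $A^\pi:=A+\mathcal{K}(\mathcal{X})$, and $L^\pi(a):=(L(a))^\pi$, $T^\pi(a):=(T(a))^\pi$; quotient algebras carry the quotient norm. *)

(* Defs.v *)
From HB Require Import structures.
From mathcomp Require Import all_boot all_order all_algebra finmap.
From mathcomp Require Import all_classical all_reals all_analysis.
From mathcomp Require Import complex.

Set Implicit Arguments.
Unset Strict Implicit.
Unset Printing Implicit Defensive.

Import Order.TTheory GRing.Theory Num.Theory.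
Import numFieldNormedType.Exports.

Local Open Scope classical_set_scope.
Local Open Scope ring_scope.
Local Open Scope complex_scope.

(* A sequence Z -> C is a function [int -> R[i]]. *)
Definition nonneg_seq (R : realType) (f : int -> R) := forall k, 0 <= f k.

(* The values of [bfn] outside [nonneg_seq] are unconstrained and never used. *)
Record banach_function_norm (R : realType) := BanachFunctionNorm {
  bfn :> (int -> R) -> \bar R ;
  bfn_ge0 : forall f : int -> R, nonneg_seq f -> (0 <= bfn f)%E ;
  bfn_eq0 : forall f : int -> R, nonneg_seq f ->
    (bfn f = 0%E <-> f = fun=> 0) ;
  bfn_scale : forall (c : R) (f : int -> R), 0 <= c -> nonneg_seq f ->
    bfn (fun k => c * f k) = (c%:E * bfn f)%E ;
  bfn_triangle : forall f g : int -> R, nonneg_seq f -> nonneg_seq g ->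
    (bfn (fun k => (f k + g k)%R) <= bfn f + bfn g)%E ;
  bfn_mono : forall f g : int -> R, nonneg_seq g -> (forall k, g k <= f k) ->
    (bfn g <= bfn f)%E ;
  bfn_fatou : forall (f_ : nat -> int -> R) (f : int -> R),
    (forall n, nonneg_seq (f_ n)) ->
    (forall n k, f_ n k <= f_ n.+1 k) ->
    (forall k, f_ n k @[n --> \oo] --> f k) ->
    (forall n, (bfn (f_ n) <= bfn (f_ n.+1))%E) /\
    bfn (f_ n) @[n --> \oo] --> bfn f ;
  bfn_indic : forall E : {fset int},
    (bfn (fun k => ((k \in E)%:R)%R) < +oo)%E ;
  bfn_sum : forall E : {fset int}, exists2 C : R, 0 < C &
    forall f : int -> R, nonneg_seq f ->
      ((\sum_(k <- E) f k)%:E <= C%:E * bfn f)%E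
}.

Section SequenceSpace.
Variables (R : realType) (rho : banach_function_norm R).
Implicit Types phi psi : int -> R[i].

Definition modulus phi : int -> R := fun k => Normc.normc (phi k).

Lemma modulus_ge0 phi : nonneg_seq (modulus phi).
Proof. by move=> k; rewrite /modulus; case: (phi k) => x y /=; exact: sqrtr_ge0. Qed.

Definition seq_space : set (int -> R[i]) :=
  [set phi | (rho (modulus phi) < +oo)%E].

Definition seq_norm phi : R := fine (rho (modulus phi)).

Lemma rho_modulus_fin phi : seq_space phi -> rho (modulus phi) \is a fin_num.
Proof.
by move=> h; rewrite ge0_fin_numE//; exact/bfn_ge0/modulus_ge0.
Qed.

Lemma rho_modulusD phi psi :
  (rho (modulus (phi + psi)%R) <= rho (modulus phi) + rho (modulus psi))%E.
Proof.
apply: le_trans (bfn_triangle rho (modulus_ge0 phi) (modulus_ge0 psi)).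
apply: bfn_mono => k; first exact: modulus_ge0.
exact: le_normcD.
Qed.

Lemma rho_modulusZ (c : R[i]) phi :
  rho (modulus (c *: phi)%R) = ((Normc.normc c)%:E * rho (modulus phi))%E.
Proof.
rewrite -bfn_scale//; last by move=> k; exact: modulus_ge0.
- by congr bfn; apply/funext => k; rewrite /modulus -Normc.normcM.
- exact: (modulus_ge0 (fun=> c) 0).
Qed.

Lemma rho_modulus0 : rho (modulus 0) = 0%E.
Proof.
apply/(bfn_eq0 rho); first by move=> k; exact: modulus_ge0.
by apply/funext => k; exact: Normc.normc0.
Qed.

Definition seq_space_pred : {pred int -> R[i]} := fun phi => phi \in seq_space.

Lemma seq_space_submod_closed : submod_closed seq_space_pred.
Proof.
split; first by rewrite inE /seq_space/= rho_modulus0.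
move=> c phi psi; rewrite !inE => fphi fpsi; rewrite /seq_space/=.
apply: (le_lt_trans (rho_modulusD _ _)); rewrite lte_add_pinfty//.
rewrite rho_modulusZ -(fineK (rho_modulus_fin fphi)) -EFinM; exact: ltry.
Qed.

HB.instance Definition _ := GRing.isSubmodClosed.Build R[i] (int -> R[i])
  seq_space_pred seq_space_submod_closed.

Record X_Z := SeqSpace {
  X_Z_val :> int -> R[i] ;
  X_Z_valP : X_Z_val \in seq_space_pred
}.

HB.instance Definition _ := [isSub for X_Z_val].
HB.instance Definition _ := [Choice of X_Z by <:].
HB.instance Definition _ := [SubChoice_isSubLmodule of X_Z by <:].

Lemma X_Z_seq_space (phi : X_Z) : seq_space phi.
Proof. by have := X_Z_valP phi; rewrite inE. Qed.

Definition X_Z_norm (phi : X_Z) : R[i] := (seq_norm phi)%:C.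

Lemma X_Z_normD (phi psi : X_Z) :
  X_Z_norm (phi + psi) <= X_Z_norm phi + X_Z_norm psi.
Proof.
rewrite /X_Z_norm -rmorphD/= lecR /seq_norm -fineD;
  [|exact/rho_modulus_fin/X_Z_seq_space..].
apply: fine_le (rho_modulusD _ _).
- exact: (rho_modulus_fin (X_Z_seq_space (phi + psi))).
- by rewrite fin_numD !(rho_modulus_fin (X_Z_seq_space _)).
Qed.

Lemma X_Z_normZ (c : R[i]) (phi : X_Z) :
  X_Z_norm (c *: phi) = `|c| * X_Z_norm phi.
Proof.
rewrite /X_Z_norm /seq_norm (rho_modulusZ c phi) fineM//.
- by rewrite rmorphM/=; case: c.
- exact: rho_modulus_fin (X_Z_seq_space phi).
Qed.

Lemma X_Z_norm0_eq0 (phi : X_Z) : X_Z_norm phi = 0 -> phi = 0.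
Proof.
move=> [] /eqP; rewrite fine_eq0 ?(rho_modulus_fin (X_Z_seq_space _))//.
move=> /eqP /(bfn_eq0 rho (modulus_ge0 _)) phi0; apply/val_inj/funext => k /=.
by apply: Normc.eq0_normc; exact: (congr1 (@^~ k) phi0).
Qed.

HB.instance Definition _ := Lmodule_isNormed.Build R[i] X_Z
  X_Z_normD X_Z_normZ X_Z_norm0_eq0.

Definition translation_invariant := forall phi, seq_space phi ->
  seq_space (fun j => phi (j - 1)) /\
  seq_norm (fun j => phi (j - 1)) = seq_norm phi.

Definition projP phi : int -> R[i] := fun j => if 0 <= j then phi j else 0.

Lemma projP_seq_space (phi : X_Z) : projP phi \in seq_space_pred.
Proof.
rewrite inE; apply: le_lt_trans (X_Z_seq_space phi).
apply: bfn_mono => k; first exact: modulus_ge0.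
rewrite /modulus /projP; case: ifP => // _.
by rewrite Normc.normc0; exact: modulus_ge0.
Qed.

Definition projX (phi : X_Z) : X_Z := SeqSpace (projP_seq_space phi).

Definition X_Zplus_pred : {pred X_Z} := fun phi : X_Z => phi \in range projX.

Lemma X_Zplus_submod_closed : submod_closed X_Zplus_pred.
Proof.
split; first by rewrite inE; exists 0 => //; apply/val_inj/funext => k /=;
  rewrite /projP if_same.
move=> c f g; rewrite !inE => -[u _ <-] [v _ <-]; exists (c *: u + v) => //.
apply/val_inj/funext => k.
change (projP (c *: u + v) k = c * projP u k + projP v k).
by rewrite /projP; case: ifP => // _; rewrite mulr0 addr0.
Qed.

HB.instance Definition _ := GRing.isSubmodClosed.Build R[i] X_Z
  X_Zplus_pred X_Zplus_submod_closed.

Record X_Zplus := SeqSpacePlus {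
  X_Zplus_val :> X_Z ;
  X_Zplus_valP : X_Zplus_val \in X_Zplus_pred
}.

HB.instance Definition _ := [isSub for X_Zplus_val].
HB.instance Definition _ := [Choice of X_Zplus by <:].
HB.instance Definition _ := [SubChoice_isSubLmodule of X_Zplus by <:].

Definition X_Zplus_norm (phi : X_Zplus) : R[i] := `|X_Zplus_val phi|.

Lemma X_Zplus_normD (phi psi : X_Zplus) :
  X_Zplus_norm (phi + psi) <= X_Zplus_norm phi + X_Zplus_norm psi.
Proof. exact: ler_normD. Qed.

Lemma X_Zplus_normZ (c : R[i]) (phi : X_Zplus) :
  X_Zplus_norm (c *: phi) = `|c| * X_Zplus_norm phi.
Proof. exact: normrZ. Qed.

Lemma X_Zplus_norm0_eq0 (phi : X_Zplus) : X_Zplus_norm phi = 0 -> phi = 0.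
Proof. by move=> /normr0_eq0 h; exact/val_inj. Qed.

HB.instance Definition _ := Lmodule_isNormed.Build R[i] X_Zplus
  X_Zplus_normD X_Zplus_normZ X_Zplus_norm0_eq0.

End SequenceSpace.

Section Operators.
Variable R : realType.
Implicit Types V W : normedModType R[i].

(* The norm of a [normedModType R[i]] takes its values in [R[i]]; they are
   real (and nonnegative). *)
Definition rnorm V (v : V) : R := complex.Re `|v|.

Definition op_norm V W (A : V -> W) : \bar R :=
  ereal_sup [set (rnorm (A x))%:E | x in [set x : V | rnorm x <= 1]].

Definition bounded_op V W : set (V -> W) :=
  [set A | linear A /\ (op_norm A < +oo)%E].

Definition compact_op V W : set (V -> W) :=
  [set K | linear K /\ precompact (K @` [set x : V | rnorm x <= 1])].

(* An element of B(V)/K(V) is represented by the set A + K(V). *)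
Definition calkin V (A : V -> V) : set (V -> V) :=
  [set (fun x => A x + K x) | K in @compact_op V V].

Definition quotient_norm V (U : set (V -> V)) : \bar R :=
  ereal_inf [set op_norm B | B in U].

Definition dual V : set (V -> R[i]^o) := @bounded_op V R[i]^o.

(* Only the values of [Phi] on [dual V] are meaningful. *)
Definition bidual V : set ((V -> R[i]^o) -> R[i]^o) :=
  [set Phi : (V -> R[i]^o) -> R[i]^o |
    (forall (c : R[i]) (f g : V -> R[i]^o), dual f -> dual g ->
       Phi (fun x => c * f x + g x) = c * Phi f + Phi g) /\
    exists M : R, forall f, dual f ->
       ((rnorm (Phi f))%:E <= M%:E * op_norm f)%E].

(* The canonical embedding V -> V** is onto. *)
Definition reflexive_space V := forall Phi, @bidual V Phi ->
  exists x : V, forall f, dual f -> Phi f = f x.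

End Operators.

Section Distributions.
Variable R : realType.

Definition smooth (f : R -> R) :=
  forall (n : nat) (x : R), derivable (derive1n n f) x 1.

(* Derivatives of complex-valued functions on R are taken on the real and the
   imaginary parts. *)
Definition periodic_test (u : R -> R[i]) :=
  [/\ smooth (fun t => complex.Re (u t)),
      smooth (fun t => complex.Im (u t)) &
      forall t, u (t + pi *+ 2) = u t].

Definition test_cvg (u_ : nat -> R -> R[i]) (u : R -> R[i]) := forall k,
  {uniform, derive1n k (fun t => complex.Re (u_ n t)) @[n --> \oo] -->
            derive1n k (fun t => complex.Re (u t))} /\
  {uniform, derive1n k (fun t => complex.Im (u_ n t)) @[n --> \oo] -->
            derive1n k (fun t => complex.Im (u t))}.

(* The test functions form a metrizable space, so that sequential continuity is
   continuity.  Only the values of [a] on [periodic_test] are meaningful. *)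
Definition periodic_distribution (a : (R -> R[i]) -> R[i]^o) :=
  (forall (c : R[i]) u v, periodic_test u -> periodic_test v ->
     a (fun t => c * u t + v t) = c * a u + a v) /\
  (forall u_ u, (forall n, periodic_test (u_ n)) -> periodic_test u ->
     test_cvg u_ u -> a (u_ n) @[n --> \oo] --> a u).

Definition expi (j : int) (t : R) : R[i] := cos (j%:~R * t) +i* sin (j%:~R * t).

(* A function f is identified with the distribution
   u |-> (2 pi)^-1 \int_0^{2 pi} f u, so that no factor appears here. *)
Definition fourier (a : (R -> R[i]) -> R[i]^o) (j : int) : R[i] :=
  a (expi (- j)).

End Distributions.

Section LaurentWienerHopf.
Variables (R : realType) (rho : banach_function_norm R).
Variable a : (R -> R[i]) -> R[i]^o.

Definition S0 : set (int -> R[i]) :=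
  [set phi | finite_set [set k | phi k != 0]].

Definition S0plus : set (int -> R[i]) := [set projP phi | phi in S0].

(* The sum over k ranges over the finitely many nonzero terms. *)
Definition convolution (phi : int -> R[i]) : int -> R[i] :=
  fun j => \sum_(k \in [set: int]) (fourier a (j - k) * phi k).

Definition multiplier_norm : \bar R :=
  ereal_sup [set (seq_norm rho (convolution phi) / seq_norm rho phi)%:E |
             phi in [set phi | S0 phi /\ phi <> fun=> 0]].

Definition multiplier :=
  [/\ periodic_distribution a,
      forall phi, S0 phi -> seq_space rho (convolution phi) &
      (multiplier_norm < +oo)%E].

Definition laurent_extension : set (X_Z rho -> X_Z rho) :=
  [set L : X_Z rho -> X_Z rho | bounded_op L /\
     forall phi : X_Z rho, S0 phi -> L phi = convolution phi :> (int -> R[i])].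

Definition wiener_hopf_extension : set (X_Zplus rho -> X_Zplus rho) :=
  [set T : X_Zplus rho -> X_Zplus rho | bounded_op T /\
     forall phi : X_Zplus rho, S0plus phi ->
       T phi = projP (convolution phi) :> (int -> R[i])].

(* L(a) and T(a).  When X(Z) is separable and a is a multiplier, S_0 is dense
   and the extensions exist and are unique; the default 0 is not used. *)
Definition laurent : X_Z rho -> X_Z rho :=
  xget (fun=> 0) laurent_extension.

Definition wiener_hopf : X_Zplus rho -> X_Zplus rho :=
  xget (fun=> 0) wiener_hopf_extension.

End LaurentWienerHopf.

Arguments laurent {R} rho a _.
Arguments wiener_hopf {R} rho a _.

(* Main.v *)
(* If [w n] is bounded and tends to 0 coordinatewise, then it tends weakly to 0:
   for an ultrafilter U on nat, the bidual element [f |-> lim_U f (w n)] is by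
   reflexivity evaluation at a point of X(Z), all of whose coordinates vanish.
   Hence K (w n) tends to 0 in norm along U for every compact K.  The shifts
   [w n] of a finitely supported [v] have the norm of [v], and the norm of A v
   is at most that of A (w n): with equality for A = L(a), and for A = T(a)
   because P (shift u) dominates shift (P u).  So the norm of A v is at most
   the norm of (A + K)(w n) plus that of K (w n), and the latter can be made
   small.

   Density of S_0 is not needed to pass to an arbitrary [v]: its truncations
   tend weakly to [v], again by reflexivity, so their images under A converge
   coordinatewise to A v, and the Fatou property makes the norm lower
   semicontinuous for this convergence. *)
Require Import Defs.
From mathcomp Require Import all_boot all_order all_algebra finmap.
From mathcomp Require Import all_classical all_reals all_analysis.
From mathcomp Require Import complex.

Set Implicit Arguments.
Unset Strict Implicit.
Unset Printing Implicit Defensive.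

Import Order.TTheory GRing.Theory Num.Theory.
Import numFieldNormedType.Exports.

Local Open Scope classical_set_scope.
Local Open Scope ring_scope.
Local Open Scope complex_scope.

(** * Limits along ultrafilters *)

Lemma ultra_cvg_compact (I : Type) (U : set_system I) (T : topologicalType)
    (A : set T) (x : I -> T) :
  UltraFilter U -> compact A -> (\forall i \near U, A (x i)) ->
  exists2 p, A p & x @ U --> p.
Proof.
move=> UU cA UA.
have [p [Ap clp]] := cA (x @ U) _ UA.
exists p => // B Bp.
(* Either the preimage of [B] or its complement lies in [U]; the latter contradicts that [p] is a
   cluster point. *)
have [//|UnB] := in_ultra_setVsetC (x @^-1` B) UU.
by have [y [nBy By]] := clp (~` B) B UnB Bp.
Qed.

Lemma ultra_cvg_bounded (R : realType) (U : set_system nat) (u : nat -> R)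
    (M : R) :
  UltraFilter U -> (forall n, `|u n| <= M) ->
  cvg (u n @[n --> U]) /\ `|lim (u n @[n --> U])| <= M.
Proof.
move=> UU uM.
have [|l + ul] := ultra_cvg_compact (x := u) UU (@segment_compact _ (- M) M).
  by apply: nearW => n; rewrite /= in_itv/= -ler_norml.
rewrite /= in_itv/= -ler_norml => lM; split; first by apply/cvg_ex; exists l.
by rewrite (cvg_lim _ ul).
Qed.

(** * The complex modulus against real and imaginary parts *)

Section ComplexNorm.
Variable R : realType.
Implicit Types z : R[i].

Lemma Re_le_normc z : `|complex.Re z| <= Normc.normc z.
Proof.
case: z => x y /=; rewrite -sqrtr_sqr ler_sqrt ?lerDl ?sqr_ge0//.
by rewrite addr_ge0 ?sqr_ge0.
Qed.

Lemma Im_le_normc z : `|complex.Im z| <= Normc.normc z.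
Proof.
case: z => x y /=; rewrite -sqrtr_sqr ler_sqrt ?lerDr ?sqr_ge0//.
by rewrite addr_ge0 ?sqr_ge0.
Qed.

Lemma normc_le_ReIm z :
  Normc.normc z <= `|complex.Re z| + `|complex.Im z|.
Proof.
case: z => x y /=; rewrite -[leRHS]ger0_norm ?addr_ge0// -sqrtr_sqr ler_sqrt ?sqr_ge0//.
rewrite sqrrD !real_normK ?num_real// -addrA lerD2l lerDr.
by rewrite mulrn_wge0// mulr_ge0.
Qed.

End ComplexNorm.

(** * Operator norms, compact operators and the quotient norm *)

Section RealNorm.
Variable R : realType.
Implicit Types V W : normedModType R[i].

Lemma rnormE V (v : V) : `|v| = (rnorm v)%:C.
Proof. by rewrite /rnorm RRe_real. Qed.

Lemma rnorm_ge0 V (v : V) : 0 <= rnorm v.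
Proof. by rewrite -lecR -rnormE; exact: normr_ge0. Qed.

Lemma rnormD V (u v : V) : rnorm (u + v) <= rnorm u + rnorm v.
Proof. by rewrite -lecR rmorphD/= -!rnormE ler_normD. Qed.

Lemma rnormN V (v : V) : rnorm (- v) = rnorm v.
Proof. by rewrite /rnorm normrN. Qed.

Lemma rnorm0 V : rnorm (0 : V) = 0.
Proof. by rewrite /rnorm normr0. Qed.

Lemma rnorm_eq0 V (v : V) : rnorm v = 0 -> v = 0.
Proof. by move=> v0; apply/eqP; rewrite -normr_eq0 rnormE v0. Qed.

Lemma rnorm_complex (z : R[i]^o) : rnorm z = Normc.normc z.
Proof. by case: z. Qed.

Lemma op_norm_ub V W (A : V -> W) (x : V) :
  rnorm x <= 1 -> ((rnorm (A x))%:E <= op_norm A)%E.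
Proof. by move=> x1; apply: ereal_sup_ubound; exists x. Qed.

Lemma op_norm_ge0 V W (A : V -> W) : (0 <= op_norm A)%E.
Proof.
apply: (le_trans _ (op_norm_ub A (x := 0) _)); last by rewrite rnorm0.
by rewrite lee_fin rnorm_ge0.
Qed.

Lemma op_norm_le V W (A : V -> W) (C : \bar R) :
  (forall x, rnorm x <= 1 -> ((rnorm (A x))%:E <= C)%E) -> (op_norm A <= C)%E.
Proof. by move=> leC; apply: ge_ereal_sup => _ [x /= x1 <-]; exact: leC. Qed.

Lemma cvg_rnorm V (U : set_system nat) {FU : Filter U} (x : nat -> V) (y : V) :
  x @ U --> y -> forall e : R, 0 < e -> \forall n \near U, rnorm (x n - y) < e.
Proof.
move=> xy e e0; have e0' : 0 < e%:C by rewrite ltcR.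
have := @cvgr_dist_lt _ _ _ _ FU _ _ xy _ e0'; apply: filterS => n.
by rewrite rnormE ltcR -rnormN opprB.
Qed.

(** An unbounded [K] would send vectors [x n] of the unit ball to images of norm above [n]; along an
    ultrafilter these converge by precompactness, so some of arbitrarily large index would have norm
    below [rnorm y + 1]. Boundedness makes the coordinates of [K] continuous functionals later
    on. *)
Lemma compact_op_bounded V W (K : V -> W) : compact_op K -> bounded_op K.
Proof.
move=> [Klin Kpre]; split=> //; apply: contrapT => /negP; rewrite -leNgt => Koo.
have xP (n : nat) : exists x : V, rnorm x <= 1 /\ n%:R < rnorm (K x).
  apply: contrapT => xN; have : (op_norm K <= (n%:R : R)%:E)%E.
    apply: op_norm_le => x x1; rewrite lee_fin leNgt; apply/negP => nKx.
    by apply: xN; exists x.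
  by move=> /(le_trans Koo); rewrite leye_eq.
pose x n := projT1 (cid (xP n)).
have x1 n : rnorm (x n) <= 1 by rewrite /x; case: cid => ? [].
have xK n : n%:R < rnorm (K (x n)) by rewrite /x; case: cid => ? [].
(* [U] contains every set of all large [n], so it inherits whatever holds eventually. *)
have [U [UU sU]] := ultraFilterLemma eventually_filter.
move: Kpre; rewrite precompactE => Kpre.
have [|y _ Ky] := ultra_cvg_compact (x := K \o x) UU Kpre.
  by apply: nearW => n; apply: subset_closure; exists (x n) => //=.
have near1 : \forall n \near U, rnorm (K (x n) - y) < 1.
  exact: (cvg_rnorm Ky ltr01).
have near2 : \forall n \near U, rnorm y + 1 <= n%:R.
  apply: sU; exists `|Num.ceil (rnorm y + 1)|%N => // n /= yn.
  apply: le_trans (ceil_ge _) _; rewrite -(ler_nat R) in yn.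
  by apply: le_trans yn; rewrite pmulrn ler_int lez_abs.
have [n []] := filter_ex (filterI near1 near2).
rewrite /comp => h1 h2; have := xK n; apply/negP; rewrite -leNgt.
apply: le_trans h2; rewrite -[K (x n)](subrK y).
by apply: le_trans (rnormD _ _) _; rewrite addrC lerD2l ltW.
Qed.

Lemma compact_op0 V W : compact_op (fun _ : V => 0 : W).
Proof.
split; first by move=> c x y; rewrite scaler0 addr0.
apply: (precompact_subset (B := [set 0])); first by move=> _ [x _ <-].
by apply: compact_precompact; [exact: norm_hausdorff|exact: compact_set1].
Qed.

Lemma quotient_norm_le V (A : V -> V) :
  (quotient_norm (calkin A) <= op_norm A)%E.
Proof.
apply: ereal_inf_lbound; exists A => //; exists (fun=> 0); first exact: compact_op0.
by apply/funext => x; rewrite addr0.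
Qed.

(** Both sides vanish; this serves the case in which [xget] returns its default. *)
Lemma quotient_norm0 V :
  quotient_norm (calkin (fun _ : V => 0)) = op_norm (fun _ : V => 0 : V).
Proof.
apply/eqP; rewrite eq_le quotient_norm_le /=; apply: (@le_trans _ _ 0%E).
  by apply: op_norm_le => x _; rewrite rnorm0.
by apply: le_ereal_inf_tmp => _ [B _ <-]; exact: op_norm_ge0.
Qed.

End RealNorm.

(** * Weak limits and lower semicontinuity of the norm *)

Section SequenceSpaceTheory.
Variables (R : realType) (rho : banach_function_norm R).
Implicit Types x y : X_Z rho.

Lemma rho_rnorm x : rho (modulus x) = (rnorm x)%:E.
Proof. by rewrite -(fineK (rho_modulus_fin (X_Z_seq_space x))). Qed.

Lemma coord_bound (k : int) : exists2 C : R, 0 < C &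
  forall x, Normc.normc (x k) <= C * rnorm x.
Proof.
have [C C0 HC] := bfn_sum rho [fset k]%fset; exists C => // x.
have := HC _ (modulus_ge0 x).
by rewrite big_seq_fset1 rho_rnorm -EFinM lee_fin.
Qed.

Lemma coord_dual (k : int) : dual (fun x => x k : R[i]^o).
Proof.
split; first by [].
have [C C0 HC] := coord_bound k; apply: (@le_lt_trans _ _ C%:E); last exact: ltry.
apply: op_norm_le => x x1; rewrite rnorm_complex lee_fin.
by apply: le_trans (HC x) _; rewrite ler_piMr// ltW.
Qed.

(* The bidual functional [f |-> lim_U f (x n)] is evaluation at some point of
   the space, which the coordinate functionals identify as [y]. *)
Lemma reflexive_weak_cvg (U : set_system nat) (x : nat -> X_Z rho) y :
  reflexive_space (X_Z rho : normedModType R[i]) -> UltraFilter U ->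
  (forall n, rnorm (x n) <= 1) ->
  (forall k, \forall n \near U, x n k = y k) ->
  forall f : X_Z rho -> R[i]^o, dual f -> forall e : R, 0 < e ->
  \forall n \near U, rnorm (f (x n) - f y) < e.
Proof.
move=> refl UU x1 xy.
pose Phi (f : X_Z rho -> R[i]^o) : R[i]^o :=
  lim (complex.Re (f (x n)) @[n --> U]) +i*
  lim (complex.Im (f (x n)) @[n --> U]).
have fbnd f : dual f -> forall n, Normc.normc (f (x n)) <= fine (op_norm f).
  move=> [_ foo] n; rewrite -lee_fin fineK ?ge0_fin_numE ?op_norm_ge0//.
  by rewrite -rnorm_complex; exact: op_norm_ub.
have cvRe f : dual f ->
    cvg (complex.Re (f (x n)) @[n --> U]) /\
    `|complex.Re (Phi f)| <= fine (op_norm f).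
  move=> df; apply: ultra_cvg_bounded => n.
  exact: le_trans (Re_le_normc _) (fbnd f df n).
have cvIm f : dual f ->
    cvg (complex.Im (f (x n)) @[n --> U]) /\
    `|complex.Im (Phi f)| <= fine (op_norm f).
  move=> df; apply: ultra_cvg_bounded => n.
  exact: le_trans (Im_le_normc _) (fbnd f df n).
have Phi_bidual : bidual Phi.
  split=> [[a b] f g df dg|]; last first.
    (* The modulus is at most the sum of the absolute values of the real and imaginary parts, each
       bounded by the norm of [f]; hence the constant 2. *)
    exists 2 => f df; rewrite -[X in (_ * X)%E]fineK; last first.
      by rewrite ge0_fin_numE ?op_norm_ge0//; case: df.
    rewrite -EFinM lee_fin rnorm_complex; apply: le_trans (normc_le_ReIm _) _.
    by rewrite mulr_natl mulr2n lerD//; [case: (cvRe f df)|case: (cvIm f df)].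
  have [fRe _] := cvRe f df; have [fIm _] := cvIm f df.
  have [gRe _] := cvRe g dg; have [gIm _] := cvIm g dg.
  apply/eqP; rewrite eq_complex; apply/andP; split; apply/eqP.
    rewrite [LHS](_ : _ =
        lim (a * complex.Re (f (x n)) - b * complex.Im (f (x n)) +
             complex.Re (g (x n)) @[n --> U])).
      by apply: cvg_lim => //; apply: cvgD => //; apply: cvgB; exact: cvgMr.
    rewrite /Phi /=; congr (lim (_ @ U)); apply/funext => n.
    by case: (f (x n)) => ? ?; case: (g (x n)).
  rewrite [LHS](_ : _ =
      lim (a * complex.Im (f (x n)) + b * complex.Re (f (x n)) +
           complex.Im (g (x n)) @[n --> U])).
    by apply: cvg_lim => //; apply: cvgD => //; apply: cvgD; exact: cvgMr.
  rewrite /Phi /=; congr (lim (_ @ U)); apply/funext => n.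
  by case: (f (x n)) => ? ?; case: (g (x n)).
have [z Phiz] := refl Phi Phi_bidual.
(* On the [k]-th coordinate functional, [Phi] is the limit of [x n k], which equals [y k] on a
   member of [U]. *)
have zy : z = y.
  apply/val_inj/funext => k /=; rewrite -(Phiz _ (coord_dual k)).
  apply/eqP; rewrite eq_complex; apply/andP; split; apply/eqP;
    by apply: cvg_lim => //; apply: cvg_near_cst; apply: filterS (xy k) => n ->.
move=> f df e e0; rewrite -zy -(Phiz f df).
have e2 : 0 < e / 2 by rewrite divr_gt0.
have nRe : \forall n \near U,
    `|complex.Re (Phi f) - complex.Re (f (x n))| < e / 2.
  by have [fRe _] := cvRe f df; exact: (@cvgr_dist_lt _ _ _ _ _ _ _ fRe _ e2).
have nIm : \forall n \near U,
    `|complex.Im (Phi f) - complex.Im (f (x n))| < e / 2.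
  by have [fIm _] := cvIm f df; exact: (@cvgr_dist_lt _ _ _ _ _ _ _ fIm _ e2).
apply: filterS (filterI nRe nIm) => n [hRe hIm].
rewrite -rnormN opprB rnorm_complex; apply: le_lt_trans (normc_le_ReIm _) _.
rewrite [ltRHS]splitr; apply: ltrD.
  by move: hRe; case: (Phi f) => ? ?; case: (f (x n)).
by move: hIm; case: (Phi f) => ? ?; case: (f (x n)).
Qed.

(** Gives windows around 0 the type [{fset int}] on which [bfn_indic] and [filter_bigI] operate. *)
Lemma window_fset (M : nat) :
  exists E : {fset int}, forall k : int, (k \in E) = (`|k|%N <= M)%N.
Proof.
exists [fset k in map Posz (iota 0 M.+1) ++
                  map (fun j => - Posz j) (iota 0 M.+1)]%fset => k.
rewrite in_fset mem_cat; apply/orP/idP.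
  by move=> [] /mapP [j]; rewrite mem_iota/= => jM ->; rewrite ?abszN.
move=> kM; case: (lerP 0 k) => k0; [left|right]; apply/mapP; exists `|k|%N;
  rewrite ?mem_iota//=.
- by rewrite gez0_abs.
- by rewrite ltz0_abs// opprK.
Qed.

(** On a finite window one index [n] makes [modulus y] at most [modulus (x n)] plus a small multiple
    of the indicator, whose norm is finite. This bounds each windowed [w M] by [C], and the Fatou
    property lets the windows grow. *)
Lemma rnorm_fatou (U : set_system nat) (x : nat -> X_Z rho) y (C : R) :
  ProperFilter U ->
  (forall k (e : R), 0 < e -> \forall n \near U, Normc.normc (x n k - y k) < e) ->
  (forall n, rnorm (x n) <= C) -> rnorm y <= C.
Proof.
move=> PU xy xC.
pose w (M : nat) (k : int) : R := if (`|k|%N <= M)%N then modulus y k else 0.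
have w0 M : nonneg_seq (w M).
  by move=> k; rewrite /w; case: ifP => // _; exact: modulus_ge0.
have [//|M k|k|_ wy] := bfn_fatou rho (f_ := w) (f := modulus y).
- rewrite /w; case: ifP => kM; last first.
    by case: ifP => // _; exact: modulus_ge0.
  by rewrite (leq_trans kM).
- apply: cvg_near_cst; exists `|k|%N => // M /= kM.
  by rewrite /w kM.
suff wC M : (rho (w M) <= C%:E)%E.
  rewrite -lee_fin -rho_rnorm -(cvg_lim _ wy)//.
  by apply: lime_le; [apply/cvg_ex; eexists; exact: wy|exact: nearW].
have [E EM] := window_fset M.
pose chi (k : int) : R := ((k \in E)%:R)%R.
have chi0 : nonneg_seq chi by move=> k; rewrite /chi ler0n.
have chi_fin : rho chi \is a fin_num.
  by rewrite ge0_fin_numE ?bfn_ge0//; exact: bfn_indic.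
apply/lee_addgt0Pr => e e0.
(* Adding 1 makes the denominator positive without a lower bound on [rho chi], while [d] times
   [rho chi] stays at most [e]. *)
pose d := e / (fine (rho chi) + 1).
have chi_ge0 : 0 <= fine (rho chi) by rewrite fine_ge0// bfn_ge0.
have d0 : 0 < d by rewrite divr_gt0// ltr_wpDl.
have [n xn] : exists n, forall k, k \in E -> Normc.normc (x n k - y k) < d.
  have := filter_bigI (D := E)
    (f := fun k => [set n | Normc.normc (x n k - y k) < d]) PU.
  by move=> /(_ (fun k _ => xy k d d0)) /filter_ex [n xn]; exists n; exact: xn.
apply: (@le_trans _ _ (rho (fun k => modulus (x n) k + d * chi k)%R)).
  apply: bfn_mono => // k; rewrite /w -EM /chi.
  case: (boolP (k \in E)) => kE /=; last by rewrite mulr0 addr0 modulus_ge0.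
  rewrite mulr1 /modulus -[y k](subrK (x n k)) addrC.
  apply: le_trans (le_normcD _ _) _; rewrite lerD2l ltW//.
  by rewrite -normcN opprB; exact: xn.
apply: le_trans (bfn_triangle rho (modulus_ge0 _) _) _.
  by move=> k; rewrite mulr_ge0 ?chi0// ltW.
rewrite rho_rnorm bfn_scale ?(ltW d0)// -(fineK chi_fin) -EFinM -!EFinD lee_fin lerD//.
by rewrite /d mulrAC ler_pdivrMr ?ltr_wpDl// ler_wpM2l ?lerDl// ltW.
Qed.

End SequenceSpaceTheory.

(** * Compact perturbations on a complemented subspace *)

Section WeaklyNullSequences.
Variables (R : realType) (rho : banach_function_norm R).
Hypothesis refl : reflexive_space (X_Z rho : normedModType R[i]).
(* [V] is a 1-complemented subspace of [X_Z rho], with inclusion [i] and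
   projection [p]; it will be either [X_Z rho] or [X_Zplus rho]. *)
Variables (V : normedModType R[i]) (i : V -> X_Z rho) (p : X_Z rho -> V).
Hypotheses (i_lin : linear i) (p_lin : linear p) (iK : cancel i p).
Hypothesis i_norm : forall v, rnorm (i v) = rnorm v.
Hypothesis p_norm : forall x, rnorm (p x) <= rnorm x.

(** A functional [f] on [V] extends to [f \o p] on the reflexive space without increase of norm, so
    weak convergence there passes to [V]. *)
Lemma complemented_weak_cvg (U : set_system nat) (x : nat -> V) (y : V) :
  UltraFilter U -> (forall n, rnorm (x n) <= 1) ->
  (forall k, \forall n \near U, i (x n) k = i y k) ->
  forall f : V -> R[i]^o, dual f -> forall e : R, 0 < e ->
  \forall n \near U, rnorm (f (x n) - f y) < e.
Proof.
move=> UU x1 xy f [flin foo] e e0.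
have dfp : dual (f \o p : X_Z rho -> R[i]^o).
  split; first by move=> c u v; rewrite /comp p_lin flin.
  apply: le_lt_trans foo; apply: op_norm_le => u u1.
  by apply: op_norm_ub; exact: le_trans (p_norm u) u1.
have ix1 n : rnorm (i (x n)) <= 1 by rewrite i_norm.
have := reflexive_weak_cvg refl UU ix1 xy dfp e0.
by apply: filterS => n; rewrite /comp !iK.
Qed.

(** Turns weak convergence of vectors into coordinatewise convergence of their images under [A]. *)
Lemma bounded_coord_dual (A : V -> V) (k : int) :
  bounded_op A -> dual (fun v => i (A v) k : R[i]^o).
Proof.
move=> [Alin Aoo]; split; first by move=> c u v; rewrite Alin i_lin.
have [C C0 HC] := coord_bound rho k.
apply: (@le_lt_trans _ _ (C * fine (op_norm A))%:E); last exact: ltry.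
apply: op_norm_le => v v1; rewrite rnorm_complex lee_fin.
apply: le_trans (HC _) _; rewrite i_norm ler_wpM2l ?(ltW C0)// -lee_fin.
by rewrite fineK ?ge0_fin_numE ?op_norm_ge0//; exact: op_norm_ub.
Qed.

(** Precompactness gives a norm limit [y] of [K (w n)] along [U]. Each coordinate of [K] is a
    bounded functional and [w] is weakly null, so every coordinate of [y] is 0. *)
Lemma compact_op_null (U : set_system nat) (K : V -> V) (w : nat -> V) :
  UltraFilter U -> compact_op K -> (forall n, rnorm (w n) <= 1) ->
  (forall k, \forall n \near U, i (w n) k = 0) ->
  forall e : R, 0 < e -> \forall n \near U, rnorm (K (w n)) < e.
Proof.
move=> UU cK w1 w0.
have [Klin Koo] := compact_op_bounded cK.
have [_] := cK; rewrite precompactE => Kpre.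
have [|y _ Ky] := ultra_cvg_compact (x := K \o w) UU Kpre.
  by apply: nearW => n; apply: subset_closure; exists (w n) => //=.
have lin0 (W W' : normedModType R[i]) (f : W -> W') : linear f -> f 0 = 0.
  by move=> flin; have := flin (-1) 0 0; rewrite scaler0 addr0 scaleN1r addNr.
suff y0 : y = 0.
  move=> e e0; have : \forall n \near U, rnorm (K (w n) - y) < e.
    exact: (cvg_rnorm Ky e0).
  by rewrite y0; apply: filterS => n; rewrite subr0.
rewrite -[y]iK; suff -> : i y = 0 by exact: lin0.
apply/val_inj/funext => k /=; apply: Normc.eq0_normc; apply/eqP.
rewrite eq_le [X in _ && X](modulus_ge0 (i y)) andbT.
apply/ler_addgt0Pr => e e0; rewrite add0r.
have [C C0 HC] := coord_bound rho k.
have e2 : 0 < e / 2 by rewrite divr_gt0.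
(* Since [C] bounds the [k]-th coordinate by the norm, this radius keeps that coordinate within
   [e / 2]. *)
have eC : 0 < e / 2 / C by rewrite divr_gt0.
have n1 : \forall n \near U, rnorm (K (w n) - y) < e / 2 / C.
  exact: (cvg_rnorm Ky eC).
have w0' l : \forall n \near U, i (w n) l = i 0 l.
  by apply: filterS (w0 l) => n ->; rewrite lin0.
have iK0 : i (K 0) = 0 by rewrite (lin0 _ _ K)// lin0.
have n2 : \forall n \near U, Normc.normc (i (K (w n)) k) < e / 2.
  have := complemented_weak_cvg UU w1 w0'
    (bounded_coord_dual k (conj Klin Koo)) e2.
  apply: filterS => n.
  by rewrite iK0 rnorm_complex [X in _ - X](_ : _ = 0)// subr0.
have [n [h1 h2]] := filter_ex (filterI n1 n2).
have h3 : Normc.normc (i (K (w n) - y) k) <= e / 2.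
  apply: le_trans (HC _) _; rewrite i_norm mulrC -ler_pdivlMr//; exact: ltW.
have -> : i y k = i (K (w n)) k - i (K (w n) - y) k.
  have -> : i (K (w n) - y) = i (K (w n)) - i y.
    by rewrite -[- y]scaleN1r addrC i_lin scaleN1r addrC.
  by rewrite /= opprB addrC subrK.
rewrite [leRHS]splitr; apply: le_trans (le_normcD _ _) _.
by rewrite lerD ?normcN//; exact: ltW.
Qed.

(** [D] will be the finitely supported elements, and [t] the truncations of [v]. *)
Variable D : set V.
Hypothesis D_approx : forall v : V, exists t : nat -> V,
  (forall n, D (t n) /\ rnorm (t n) <= rnorm v) /\
  (forall k, \forall n \near \oo, i (t n) k = i v k).

(** [D_approx] controls coordinates rather than distances, so the bound reaches [v] through
    [rnorm_fatou] instead of the norm continuity of [A]. *)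
Lemma op_norm_le_dense (A : V -> V) (C : R) : bounded_op A ->
  (forall v, D v -> rnorm v <= 1 -> rnorm (A v) <= C) ->
  (op_norm A <= C%:E)%E.
Proof.
move=> bA AleC; apply: op_norm_le => v v1; rewrite lee_fin.
have [t [tD tv]] := D_approx v.
have t1 n : rnorm (t n) <= 1 by apply: le_trans v1; case: (tD n).
have [U [UU sU]] := ultraFilterLemma eventually_filter.
rewrite -i_norm; apply: (@rnorm_fatou _ _ U (fun n => i (A (t n)))).
- move=> k e e0.
  have tv' l : \forall n \near U, i (t n) l = i v l by exact/sU/tv.
  have := complemented_weak_cvg UU t1 tv' (bounded_coord_dual k bA) e0.
  by apply: filterS => n; rewrite rnorm_complex.
- by move=> n; rewrite i_norm; apply: AleC => //; case: (tD n).
Qed.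

Lemma quotient_norm_calkin (A : V -> V) : bounded_op A ->
  (forall v, D v -> exists w : nat -> V,
    (forall n, rnorm (w n) <= rnorm v /\ rnorm (A v) <= rnorm (A (w n))) /\
    (forall k, \forall n \near \oo, i (w n) k = 0)) ->
  quotient_norm (calkin A) = op_norm A.
Proof.
move=> bA shift; apply/eqP; rewrite eq_le quotient_norm_le /=.
apply: le_ereal_inf_tmp => _ [_ [K cK <-] <-].
set B := fun x => _.
(* An infinite norm makes the bound trivial; a finite one can serve as the real constant in
   [op_norm_le_dense]. *)
have [->|Boo] := eqVneq (op_norm B) +oo%E; first exact: leey.
have Bfin : op_norm B \is a fin_num.
  by rewrite ge0_fin_numE ?op_norm_ge0// lt_neqAle Boo leey.
rewrite -(fineK Bfin); apply: op_norm_le_dense => // v Dv v1.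
apply/ler_addgt0Pr => e e0.
have [w [wv w0]] := shift v Dv.
have w1 n : rnorm (w n) <= 1 by apply: le_trans v1; case: (wv n).
have [U [UU sU]] := ultraFilterLemma eventually_filter.
have w0' k : \forall n \near U, i (w n) k = 0 by exact/sU/w0.
(* One index suffices, because the comparison of [A v] with [A (w n)] holds for every [n]. *)
have [n Kn] := filter_ex (compact_op_null UU cK w1 w0' e0).
have [_ Avw] := wv n; apply: (le_trans Avw).
have -> : A (w n) = B (w n) - K (w n) by rewrite /B addrK.
apply: le_trans (rnormD _ _) _; rewrite rnormN lerD ?(ltW Kn)//.
by rewrite -lee_fin fineK//; exact: op_norm_ub.
Qed.

End WeaklyNullSequences.

(** * Finitely supported sequences, shifts and convolution *)

Section FiniteSupport.
Variable R : realType.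
Implicit Types phi psi : int -> R[i].

Lemma sub_S0 phi psi :
  (forall k, phi k = 0 -> psi k = 0) -> S0 phi -> S0 psi.
Proof.
move=> phipsi; apply: sub_finite_set => k /=.
by apply: contra_neq; exact: phipsi.
Qed.

Lemma S0_shift phi (c : int) : S0 phi -> S0 (fun j => phi (j - c)).
Proof.
move=> /(finite_image (fun k => k + c)); apply: sub_finite_set => k /= phik.
by exists (k - c); rewrite ?subrK.
Qed.

(** For each of the finitely many [j] in the support, [k - n] differs from [j] once [n] exceeds the
    absolute value of [k - j]. *)
Lemma S0_shift_null phi (k : int) : S0 phi ->
  \forall n \near \oo, phi (k - (n : nat)%:Z) = 0.
Proof.
rewrite /S0 /= => fphi.
have : \forall n \near \oo,
    (\bigcap_(j in [set` fset_set [set j | phi j != 0]])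
      [set n : nat | k - n%:Z != j]) n.
  apply: filter_bigI => j _; exists `|k - j|.+1 => // n /= kn.
  by apply: contraTneq kn => <-; rewrite opprB addrC subrK -ltnNge ltnS.
apply: filterS => n kn; apply: contrapT => /eqP phikn.
suff : k - n%:Z != k - n%:Z by rewrite eqxx.
by apply: kn; rewrite /= in_fset_set// inE.
Qed.

(** The kernel depends only on the difference [j - k], so substituting [k + c] for [k] moves the
    shift outside. *)
Lemma convolution_shift (a : (R -> R[i]) -> R[i]^o) phi (c : int) :
  convolution a (fun j => phi (j - c)) = fun j => convolution a phi (j - c).
Proof.
apply/funext => j; rewrite /convolution.
rewrite (reindex_fsbigT (fun k : int => k + c)).
  by apply: eq_fsbigr => k _; rewrite addrK opprD addrA addrAC.
by exists (fun k => k - c) => k; rewrite ?addrK ?subrK.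
Qed.

End FiniteSupport.

(** * Truncations, isometric shifts and the two operators *)

Section TranslationInvariantSpace.
Variables (R : realType) (rho : banach_function_norm R).
Implicit Types x y : X_Z rho.

Lemma dominated_seq_space x (phi : int -> R[i]) :
  (forall k, Normc.normc (phi k) <= Normc.normc (x k)) ->
  phi \in seq_space_pred rho.
Proof.
move=> phix; rewrite inE; apply: le_lt_trans (X_Z_seq_space x).
by apply: bfn_mono => //; exact: modulus_ge0.
Qed.

Lemma dominated_rnorm x y :
  (forall k, Normc.normc (x k) <= Normc.normc (y k)) -> rnorm x <= rnorm y.
Proof.
move=> xy; rewrite -lee_fin -!rho_rnorm.
by apply: bfn_mono => //; exact: modulus_ge0.
Qed.

Definition trunc_seq (n : nat) (phi : int -> R[i]) : int -> R[i] :=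
  fun k => if (`|k|%N <= n)%N then phi k else 0.

Lemma trunc_seq_le n (phi : int -> R[i]) (k : int) :
  Normc.normc (trunc_seq n phi k) <= Normc.normc (phi k).
Proof.
rewrite /trunc_seq; case: ifP => // _.
by rewrite Normc.normc0; exact: (modulus_ge0 phi).
Qed.

Definition truncX n x : X_Z rho :=
  SeqSpace (dominated_seq_space (trunc_seq_le n x)).

Lemma S0_truncX n x : S0 (truncX n x).
Proof.
have [E EP] := window_fset n; apply: (sub_finite_set _ (finite_fset E)).
move=> k /=; rewrite EP /trunc_seq; case: ifP => //.
by rewrite eqxx.
Qed.

Lemma truncX_cvg x k : \forall n \near \oo, truncX n x k = x k.
Proof. by exists `|k|%N => // n /= kn; rewrite /trunc_seq kn. Qed.

Lemma rnorm_truncX n x : rnorm (truncX n x) <= rnorm x.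
Proof. by apply: dominated_rnorm => k; exact: trunc_seq_le. Qed.

Hypothesis rho_trans : translation_invariant rho.

Lemma shift_seq_space (n : nat) (phi : int -> R[i]) : seq_space rho phi ->
  seq_space rho (fun j => phi (j - n%:Z)) /\
  seq_norm rho (fun j => phi (j - n%:Z)) = seq_norm rho phi.
Proof.
move=> Xphi; elim: n => [|n [Xn normn]].
  by rewrite (_ : (fun j => _) = phi)//; apply/funext => j; rewrite subr0.
rewrite (_ : (fun j => _) = fun j => (fun l => phi (l - n%:Z)) (j - 1)).
  by have [? ->] := rho_trans Xn.
by apply/funext => j; rewrite -addrA -opprD intS.
Qed.

Lemma shiftX_subproof n x :
  (fun j => x (j - n%:Z)) \in seq_space_pred rho.
Proof. by rewrite inE; have [] := shift_seq_space n (X_Z_seq_space x). Qed.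

Definition shiftX n x : X_Z rho := SeqSpace (shiftX_subproof n x).

Lemma rnorm_shiftX n x : rnorm (shiftX n x) = rnorm x.
Proof. by have [] := shift_seq_space n (X_Z_seq_space x). Qed.

Lemma quotient_norm_laurent (a : (R -> R[i]) -> R[i]^o)
    (L : X_Z rho -> X_Z rho) :
  reflexive_space (X_Z rho : normedModType R[i]) ->
  laurent_extension a L -> quotient_norm (calkin L) = op_norm L.
Proof.
move=> refl [bL LE].
apply: (@quotient_norm_calkin _ _ refl _ id id _ _ _ _ _
  [set x : X_Z rho | S0 x]) => //.
  move=> x; exists (truncX ^~ x); split; last exact: truncX_cvg.
  by move=> n; split; [exact: S0_truncX|exact: rnorm_truncX].
move=> x Sx; exists (shiftX ^~ x); split; last by move=> k; exact: S0_shift_null.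
move=> n; split; first by rewrite rnorm_shiftX.
(* On finitely supported sequences [L] is a convolution, hence commutes with shifts, which are
   isometric. *)
rewrite (_ : L (shiftX n x) = shiftX n (L x)) ?rnorm_shiftX//.
apply/val_inj; rewrite /= LE; last exact: S0_shift.
by rewrite LE// convolution_shift.
Qed.

Lemma projX_range x : projX x \in @X_Zplus_pred R rho.
Proof. by rewrite inE; exists x. Qed.

Definition projXplus x : X_Zplus rho := SeqSpacePlus (projX_range x).

Lemma projP_X_Zplus (v : X_Zplus rho) : projP v = v :> (int -> R[i]).
Proof.
have := X_Zplus_valP v; rewrite inE => -[x _ <-] /=.
by apply/funext => k; rewrite /projX /= /projP; case: (0 <= k).
Qed.

Lemma X_Zplus_lt0 (v : X_Zplus rho) (k : int) : k < 0 -> v k = 0.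
Proof.
move=> k0; rewrite -[LHS](congr1 (@^~ k) (projP_X_Zplus v)) /=.
by rewrite /projP leNgt k0.
Qed.

Lemma projP_le (phi : int -> R[i]) k :
  Normc.normc (projP phi k) <= Normc.normc (phi k).
Proof.
rewrite /projP; case: ifP => // _.
by rewrite Normc.normc0; exact: (modulus_ge0 phi).
Qed.

Lemma rnorm_projXplus x : rnorm (projXplus x) <= rnorm x.
Proof. by apply: (@dominated_rnorm (projX x)) => k; exact: projP_le. Qed.

Lemma S0plusP (v : X_Zplus rho) : S0plus v <-> S0 v.
Proof.
split=> [[phi Sphi <-]|Sv]; last by exists v; rewrite ?projP_X_Zplus.
by apply: sub_S0 Sphi => k phik; rewrite /projP phik if_same.
Qed.

Lemma projXplus_linear : linear projXplus.
Proof.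
move=> c x y; apply/val_inj/val_inj/funext => k.
change (projP (c *: x + y) k = c * projP x k + projP y k).
by rewrite /projP; case: ifP => // _; rewrite mulr0 addr0.
Qed.

Lemma projXplusK : cancel (@X_Zplus_val R rho) projXplus.
Proof. by move=> v; apply/val_inj/val_inj => /=; exact: projP_X_Zplus. Qed.

(** If [k] is negative then so is [k - n], where [v] vanishes: the shifts must go to the right. *)
Lemma projP_shift (v : X_Zplus rho) (n : nat) :
  projP (fun j => v (j - n%:Z)) = fun j => v (j - n%:Z).
Proof.
apply/funext => k; rewrite /projP; case: lerP => // k0.
rewrite X_Zplus_lt0// subr_lt0; exact: lt_le_trans k0 _.
Qed.

Lemma quotient_norm_wiener_hopf (a : (R -> R[i]) -> R[i]^o)
    (T : X_Zplus rho -> X_Zplus rho) :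
  reflexive_space (X_Z rho : normedModType R[i]) ->
  wiener_hopf_extension a T -> quotient_norm (calkin T) = op_norm T.
Proof.
move=> refl [bT TE].
apply: (@quotient_norm_calkin _ _ refl _ (@X_Zplus_val R rho) projXplus
  _ _ _ _ _ [set v : X_Zplus rho | S0plus v]) => //.
- exact: projXplus_linear.
- exact: projXplusK.
- exact: rnorm_projXplus.
- move=> v; exists (fun n => projXplus (truncX n v)); split=> [n|k].
    split; last exact: le_trans (rnorm_projXplus _) (rnorm_truncX n v).
    by exists (truncX n v) => //; exact: S0_truncX.
  apply: filterS (truncX_cvg v k) => n vk.
  move: vk; rewrite /= /projP => ->; case: lerP => // k0.
  by rewrite X_Zplus_lt0.
move=> v Sv; have S0v : S0 v by exact/S0plusP.
pose w n := projXplus (shiftX n v).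
have wE n : w n = (fun j => v (j - n%:Z)) :> (int -> R[i]).
  by rewrite /= projP_shift.
exists w; split=> [n|k]; last first.
  by apply: filterS (S0_shift_null k S0v) => n vk; rewrite wE; exact: vk.
split; first by apply: le_trans (rnorm_projXplus _) _; rewrite rnorm_shiftX.
rewrite -[leLHS](rnorm_shiftX n).
apply: (@dominated_rnorm _ (T (w n))) => k /=.
have Swn : S0plus (w n) by apply/S0plusP; rewrite wE; exact: S0_shift.
rewrite !TE// wE convolution_shift {1}/projP subr_ge0.
(* For [n <= k] both sides are the modulus of entry [k - n] of the convolution of [a] with [v]; for
   smaller [k] the shift of [T v] vanishes, while [T (w n)] may not. *)
case: ifP => nk; first by rewrite /projP (le_trans _ nk).
by rewrite Normc.normc0; exact: (modulus_ge0 (projP _)).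
Qed.

End TranslationInvariantSpace.

Theorem theorem2p4 (R : realType) (rho : banach_function_norm R)
    (rho_refl : reflexive_space (X_Z rho : normedModType R[i]))
    (rho_trans : translation_invariant rho)
    (a : (R -> R[i]) -> R[i]^o) (a_mult : multiplier rho a) :
  quotient_norm (calkin (laurent rho a)) = op_norm (laurent rho a) /\
  quotient_norm (calkin (wiener_hopf rho a)) = op_norm (wiener_hopf rho a).
Proof.
split.
(* Were there no extension, the default operator 0 would satisfy the equality
   too, so neither density of S_0 nor completeness is needed for existence. *)
- rewrite /laurent; case: xgetP => [L _ LP|_].
    exact: quotient_norm_laurent LP.
  exact: quotient_norm0.
- rewrite /wiener_hopf; case: xgetP => [T _ TP|_].
    exact: quotient_norm_wiener_hopf TP.
  exact: quotient_norm0.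
Qed.
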